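(* Let $\alpha>0$. For each $n\ge 3$ let $t_n=\left\lfloor \frac{\alpha n^3}{2\pi^2}\right\rfloor$, let $(X_s)_{0\le s\le t_n}$ be the simple random walk on the ring graph $R_n$ started at the site $\lfloor n/2\rfloor$ and conditioned on not hitting the origin $0$ up to time $t_n$, and let $V_{t_n}=\{x\in R_n : X_s\neq x \text{ for all } 0\le s\le t_n\}$ be its vacant set. Then, as $n\to\infty$, $V_{t_n}$ converges in law to $\mathcal{V}^\alpha$, the vacant set of one-dimensional random interlacements at level $\alpha$.
   Context: The ring graph $R_n$ has vertex set $\{0,1,\dots,n-1\}$ with edges between $i$ and $i+1$ modulo $n$. The simple random walk on $R_n$ jumps to each of the two neighbours with probability $1/2$. Conditioning on not hitting the origin up to time $t$ means conditioning the simple random walk $(X_s)$ on the event $\{X_s\ne 0 \text{ for all } 0\le s\le t\}$; equivalently, one considers the simple random walk on $\mathbb{Z}$ started in $\{1,\dots,n-1\}$ conditioned on not hitting $\{0,n\}$ up to time $t$. The vacant set $\mathcal{V}^\alpha$ of one-dimensional random interlacements at level $\alpha$ is the random subset of $\mathbb{Z}$ whose law is characterized by $$\mathbb{P}[A\subset \mathcal{V}^\alpha]=\exp\left\{-\tfrac{\alpha}{2}\,\mathrm{Diam}(A\cup\{0\})\right\}\quad\text{for all finite } A\subset\mathbb{Z},$$ where $\mathrm{Diam}(B)=\max B-\min B$. (It is an interval containing the origin.) Convergence in law of $V_{t_n}$ to $\mathcal{V}^\alpha$ is local around the origin: for fixed integers $a,b>0$ and $n>a+b$, the interval $[-a,b]\subset\mathbb{Z}$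 is identified with its image in $R_n$ modulo $n$ (so $-i$ corresponds to the site $n-i$), and for every such $a,b$ the law of the random set $V_{t_n}\cap[-a,b]$ converges to the law of $\mathcal{V}^\alpha\cap[-a,b]$ as $n\to\infty$. *)

(* Defs.v *)
From mathcomp Require Import all_boot all_order all_algebra finmap.
From mathcomp Require Import all_classical all_reals all_analysis.

Set Implicit Arguments.
Unset Strict Implicit.
Unset Printing Implicit Defensive.

Import Order.TTheory GRing.Theory Num.Theory.
Import numFieldNormedType.Exports.

Local Open Scope classical_set_scope.
Local Open Scope ring_scope.

Definition ring_edge (n : nat) (i j : 'I_n) : bool :=
  (j == ordS i) || (i == ordS j).

(* Trajectories (X_0, ..., X_t) on R_n. *)
Definition trajectory (n t : nat) := {ffun 'I_t.+1 -> 'I_n}.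

(* The kernel is stochastic for n >= 3, when the two neighbours of a site are
   distinct. *)
Definition srw_kernel (R : realType) (n : nat) (i j : 'I_n) : R :=
  if ring_edge i j then 2^-1 else 0.

(* Here widen_ord (leqnSn t) s and lift ord0 s are the times s and s + 1. *)
Definition srw_mass (R : realType) (n t x0 : nat) (X : trajectory n t) : R :=
  (X ord0 == x0 :> nat)%:R *
  \prod_(s < t) srw_kernel R (X (widen_ord (leqnSn t) s)) (X (lift ord0 s)).

Definition srw_prob (R : realType) (n t x0 : nat) (E : set (trajectory n t)) : R :=
  \sum_(X | X \in E) srw_mass R x0 X.

Definition avoids_origin (n t : nat) : set (trajectory n t) :=
  [set X : trajectory n t | forall s, X s != 0%N :> nat].

Definition srw_cond_prob (R : realType) (n t x0 : nat)
    (E : set (trajectory n t)) : R :=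
  srw_prob R x0 (E `&` @avoids_origin n t) / srw_prob R x0 (@avoids_origin n t).

Definition vacant_set (n t : nat) (X : trajectory n t) : set 'I_n :=
  [set x | forall s, X s != x].

Definition window (a b : nat) : set int := [set z | - a%:Z <= z <= b%:Z].

(* The integers whose residue class mod n, seen as a site of R_n, is in V. *)
Definition ring_lift (n : nat) (V : set 'I_n) : set int :=
  [set z | exists2 x, V x & (x : nat)%:Z = (z %% n%:Z)%Z].

(* max B - min B for nonempty B; the head of the enumeration of B is only used
   as the initial value of the two iterated operations. *)
Definition Diam (B : {fset int}) : int :=
  \big[Order.max/head 0 B]_(z <- B) z - \big[Order.min/head 0 B]_(z <- B) z.

(* V is a random subset of Z (for the sigma-algebra generated by the events
   z \in V) that has the law of the vacant set of random interlacements at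
   level alpha. *)
Definition interlacement_vacant_set (R : realType) (alpha : R)
    (d : measure_display) (T : measurableType d) (P : probability T R)
    (V : T -> set int) : Prop :=
  (forall z : int, measurable [set w | V w z]) /\
  (forall A : {fset int},
     P [set w | [set` A] `<=` V w] =
     (expR (- (alpha / 2 * (Diam (0 |` A)%fset)%:~R)))%:E).

Definition time_horizon (R : realType) (alpha : R) (n : nat) : nat :=
  Num.truncn (alpha * n%:R ^+ 3 / (2 * pi ^+ 2)).

(* Main.v *)
(* A walk started between two points that it must avoid stays between them, so
   avoiding 0 and a set A with extreme points -l and r amounts to staying inside
   an interval of length n - (l + r). The survival probability in an interval of
   length m has an explicit expansion in the eigenfunctions sin (k pi x / m), and
   after n^3 steps only the largest eigenvalue cos (pi / m) (and its negative,
   whose coefficient vanishes in the limit) matters. Hence P(A vacant) behaves as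
   (cos (pi / (n - l - r)) / cos (pi / n)) ^ t_n, which tends to
   exp (- alpha (l + r) / 2). The probabilities of the events that A is vacant
   determine the law on a finite window by inclusion-exclusion. *)
Require Import Defs.
From mathcomp Require Import all_boot all_order all_algebra finmap.
From mathcomp Require Import all_classical all_reals all_analysis.
From mathcomp Require Import ring lra zify.

Import Order.TTheory GRing.Theory Num.Theory.
Import numFieldNormedType.Exports.

Local Open Scope classical_set_scope.
Local Open Scope ring_scope.

(** * Spectral expansion of the survival probability *)

Lemma sin_natmul_pi (R : realType) k : sin (k%:R * pi) = 0 :> R.
Proof. by rewrite mulr_natl -[_ *+ _]add0r (alternatingn (@sinDpi R)) sin0 mulr0. Qed.

(** Telescoping: [2 sin(phi) cos((2j+1) phi) = sin((2j+2) phi) - sin(2j phi)]. The factor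
    [2 sin phi] stays on the left to avoid a division. *)
Lemma sum_cos_odd (R : realType) (m : nat) (phi : R) :
  (\sum_(j < m) cos (j.*2.+1%:R * phi)) * (2 * sin phi) = sin (m.*2%:R * phi).
Proof.
elim: m => [|m IHm]; first by rewrite big_ord0 !mul0r sin0.
have E k : k.+1%:R * phi = k%:R * phi + phi by rewrite -natr1 mulrDl mul1r.
rewrite big_ord_recr /= mulrDl IHm doubleS !E !sinD cosD.
have := cos2Dsin2 phi.
move: (sin phi) (cos phi) (sin (m.*2%:R * phi)) (cos (m.*2%:R * phi)) => s c S C h.
have {1}-> : S = S * (c ^+ 2 + s ^+ 2) by rewrite h mulr1.
ring.
Qed.

Section survival.
Context {R : realType}.
Implicit Types (m x t j : nat).

(** Half of the frequency [(2j+1) pi / m]; with half-angles the coefficients in the expansion of the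
    constant 1 are cotangents. *)
Definition mode_angle m j : R := j.*2.+1%:R * (pi / m.*2%:R).

(* The probability that the simple random walk on the integers started at x does
   not hit {0, m} up to time t. The frequencies j and m - 1 - j give equal terms:
   only odd multiples of pi / m below pi contribute, each of them twice. *)
Definition survival m x t : R :=
  m%:R^-1 * \sum_(j < m) cos (mode_angle m j) / sin (mode_angle m j) *
    sin (x.*2%:R * mode_angle m j) * cos (2 * mode_angle m j) ^+ t.

Lemma mode_angle_gt0 m j : (0 < m)%N -> 0 < mode_angle m j.
Proof. by move=> m0; rewrite mulr_gt0// divr_gt0 ?pi_gt0// ltr0n double_gt0. Qed.

Lemma mode_angle_lt m j : (j < m)%N -> mode_angle m j < pi.
Proof.
move=> jm; rewrite /mode_angle mulrCA gtr_pMr ?pi_gt0// ltr_pdivrMr ?ltr0n; last by lia.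
by rewrite mul1r ltr_nat; lia.
Qed.

Lemma sin_mode_angle_gt0 m j : (j < m)%N -> 0 < sin (mode_angle m j).
Proof.
move=> jm; apply: sin_gt0_pi; rewrite mode_angle_lt// mode_angle_gt0//; lia.
Qed.

Lemma double_mode_angle m j x : (0 < m)%N ->
  x.*2%:R * mode_angle m j = j.*2.+1%:R * (x%:R * pi / m%:R).
Proof.
move=> m0; rewrite /mode_angle -!muln2 !natrM; field.
by rewrite pnatr_eq0 -lt0n.
Qed.

Lemma survival_left m t : survival m 0 t = 0.
Proof.
by rewrite /survival big1 ?mulr0// => j _; rewrite mul0r sin0 mulr0 mul0r.
Qed.

Lemma survival_right m t : survival m m t = 0.
Proof.
rewrite /survival big1 ?mulr0// => j _.
have m0 : (0 < m)%N by case: m j => // -[].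
rewrite double_mode_angle// (mulrAC m%:R) divff ?pnatr_eq0 -?lt0n// mul1r.
by rewrite sin_natmul_pi mulr0 mul0r.
Qed.

(** [x |-> sin(2xu)] is an eigenfunction of averaging over the two neighbours, with eigenvalue
    [cos(2u)]. Together with the boundary values and [survival_start], this recursion characterizes
    the survival probability. *)
Lemma survival_step m x t :
  survival m x.+1 t.+1 = (survival m x t + survival m x.+2 t) / 2.
Proof.
rewrite /survival -mulrDr -mulrA; congr (_ * _).
rewrite -big_split /= mulr_suml; apply: eq_bigr => j _.
set u := mode_angle m j.
have -> : x.+1.*2%:R * u = x.*2%:R * u + 2 * u by rewrite -mulrDl -natrD; congr (_%:R * _); lia.
have -> : x.+2.*2%:R * u = x.*2%:R * u + 2 * u + 2 * u by rewrite -!mulrDl -!natrD; congr (_%:R * _); lia.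
rewrite [in RHS]sinD [in RHS]cosD (sinD (x.*2%:R * u) (2 * u)) exprS.
have := cos2Dsin2 (2 * u).
move: (sin (2 * u)) (cos (2 * u)) (cos u / sin u) (sin (x.*2%:R * u)) (cos (x.*2%:R * u)) => s c q sx cx h.
have h' : s ^+ 2 = 1 - c ^+ 2 by rewrite -h addrAC subrr add0r.
move: (c ^+ t) => w.
have -> : (sx * c + cx * s) * c + (cx * c - sx * s) * s = sx * c ^+ 2 + 2 * cx * s * c - sx * s ^+ 2 by ring.
by rewrite h'; field.
Qed.

(** By [sum_cos_odd] at [phi = x pi / m], the sum times [2 sin phi] is [sin(2x pi) = 0]; the range
    of [x] keeps [sin phi] nonzero. *)
Lemma sum_cos_mode m x : (0 < x < m)%N ->
  \sum_(j < m) cos (x.*2%:R * mode_angle m j) = 0.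
Proof.
move=> /andP[x0 xm]; have m0 : (0 < m)%N by lia.
have sx : 0 < sin (x%:R * pi / m%:R : R).
  apply: sin_gt0_pi; rewrite divr_gt0 ?mulr_gt0 ?pi_gt0 ?ltr0n//=.
  by rewrite ltr_pdivrMr ?ltr0n// mulrC ltr_pM2l ?pi_gt0// ltr_nat.
under eq_bigr do rewrite double_mode_angle//.
apply: (mulIf (x := 2 * sin (x%:R * pi / m%:R))).
  by rewrite mulf_neq0// gt_eqF.
rewrite sum_cos_odd mul0r.
have -> : m.*2%:R * (x%:R * pi / m%:R) = x.*2%:R * pi :> R.
  by rewrite -!muln2 !natrM; field; rewrite pnatr_eq0 -lt0n.
exact: sin_natmul_pi.
Qed.

(* Telescoping in x replaces the cotangents by plain sums of cosines. *)
Lemma sum_cot_sinS m x :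
  \sum_(j < m) cos (mode_angle m j) / sin (mode_angle m j) * sin (x.+1.*2%:R * mode_angle m j) =
  \sum_(j < m) cos (mode_angle m j) / sin (mode_angle m j) * sin (x.*2%:R * mode_angle m j) +
  (\sum_(j < m) cos (x.*2%:R * mode_angle m j) + \sum_(j < m) cos (x.+1.*2%:R * mode_angle m j)).
Proof.
rewrite -!big_split /=; apply: eq_bigr => j _.
have s0 := lt0r_neq0 (sin_mode_angle_gt0 _ _ (ltn_ord j)).
move: s0; set u := mode_angle m j => s0.
have -> : x.+1.*2%:R * u = x.*2%:R * u + u + u.
  by rewrite doubleS -2!natr1; ring.
rewrite !sinD !cosD sinD.
have := cos2Dsin2 u.
move: (sin u) (cos u) (sin (x.*2%:R * u)) (cos (x.*2%:R * u)) s0 => s c sx cx s0 h.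
have -> : (sx * c + cx * s) * c + (cx * c - sx * s) * s =
    sx + s * (2 * (cx * c - sx * s)).
  have {3}-> : sx = sx * (c ^+ 2 + s ^+ 2) by rewrite h mulr1.
  ring.
have -> : (cx * c - sx * s) * c - (sx * c + cx * s) * s =
    2 * c * (cx * c - sx * s) - cx.
  have {4}-> : cx = cx * (c ^+ 2 + s ^+ 2) by rewrite h mulr1.
  ring.
by field.
Qed.

(** Induction on [x]: the cotangent sum is 0 at [x = 0], rises to [m] at [x = 1] because the [m]
    cosines at 0 equal 1, and then stays constant by [sum_cos_mode]. *)
Lemma survival_start m x : (0 < x < m)%N -> survival m x 0 = 1.
Proof.
move=> /andP[x0 xm]; have m0 : (0 < m)%N by lia.
rewrite /survival; under eq_bigr do rewrite expr0 mulr1.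
suff -> : \sum_(j < m) cos (mode_angle m j) / sin (mode_angle m j) *
   sin (x.*2%:R * mode_angle m j) = m%:R by rewrite mulVf// pnatr_eq0 -lt0n.
elim: x x0 xm => // x IHx _ xm; rewrite sum_cot_sinS (sum_cos_mode m x.+1) ?xm// addr0.
have [->|xn0] := eqVneq x 0%N.
  rewrite big1 ?add0r => [|j _]; last by rewrite mul0r sin0 mulr0.
  under eq_bigr do rewrite mul0r cos0.
  by rewrite sumr_const card_ord.
by rewrite IHx ?lt0n//; [rewrite (sum_cos_mode m x) ?addr0// lt0n xn0/=| ]; lia.
Qed.

End survival.

(** * Contribution of the non-leading eigenvalues *)

(** Applied where [|sin(k x)| = 1], this gives the lower bound [1/k] for [|sin x|]. *)
Lemma norm_sin_natmul (R : realType) k (x : R) : `|sin (k%:R * x)| <= k%:R * `|sin x|.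
Proof.
elim: k => [|k IHk]; first by rewrite !mul0r sin0 normr0.
rewrite -natr1 !mulrDl !mul1r sinD (le_trans (ler_normD _ _))//.
apply: lerD; rewrite normrM.
  by rewrite (le_trans _ IHk)// ler_piMr// cos_max.
by rewrite ler_piMl// cos_max.
Qed.

(** Cosine decreases on [[0, pi]], which gives the upper bound; the reflection about [pi / 2],
    taking [d] to [m - d], gives the lower one. *)
Lemma norm_cos_pi_frac (R : realType) (d k m : nat) : (0 < m)%N -> (d <= k <= m - d)%N ->
  `|cos (k%:R * (pi / m%:R)) : R| <= cos (d%:R * (pi / m%:R)).
Proof.
move=> m0 /andP[dk km].
have mD0 : 0 < pi / m%:R :> R by rewrite divr_gt0 ?pi_gt0 ?ltr0n.
have in0pi i : (i <= m)%N -> i%:R * (pi / m%:R) \in `[0, pi : R].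
  move=> im; rewrite in_itv /= mulr_ge0 ?ler0n ?(ltW mD0)//= mulrCA ger_pMr ?pi_gt0//.
  by rewrite ler_pdivrMr ?ltr0n// mul1r ler_nat.
have mono i j : (i <= j <= m)%N ->
    cos (j%:R * (pi / m%:R)) <= cos (i%:R * (pi / m%:R)) :> R.
  move=> /andP[ij jm]; have im := leq_trans ij jm.
  move: ij; rewrite leq_eqVlt => /predU1P[->//|ij].
  by rewrite ltW// ltr_cos ?in0pi// ltr_pM2r// ltr_nat.
rewrite ler_norml mono ?andbT; last by rewrite dk (leq_trans km)// leq_subr.
have -> : - cos (d%:R * (pi / m%:R)) = cos ((m - d)%:R * (pi / m%:R)) :> R.
  have dm : (d <= m)%N by lia.
  rewrite natrB// mulrBl (mulrCA m%:R) divff ?pnatr_eq0 -?lt0n// mulr1 addrC.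
  by rewrite cosDpi cosN.
by rewrite mono// km leq_subr.
Qed.

(** From [e^x >= 1 + x^2 / 2]. Quadratic decay suffices: with [t] of order [m^3], the resulting
    error [m^5 / t^2] still vanishes. *)
Lemma expR_decay (R : realType) (x : R) : 0 < x -> expR (- x) <= 2 / x ^+ 2.
Proof.
move=> x0; rewrite expRN -[leRHS]invrK lef_pV2 ?posrE ?expR_gt0 ?invr_gt0 ?divr_gt0 ?exprn_gt0//.
by rewrite (le_trans _ (expR_ge1Dxn 1 (ltW x0)))// invf_div lerDr.
Qed.

Section survival_bound.
Context {R : realType}.
Implicit Types (m x t j : nat).

Local Notation angle := (@mode_angle R).

(** [m] times the angle is [pi / 2 + j pi], whose sine has modulus 1; hence the sine of the angle is
    at least [1/m]. *)
Lemma norm_cot_mode_angle m j : (j < m)%N ->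
  `|cos (angle m j) / sin (angle m j)| <= m%:R.
Proof.
move=> jm; have m0 : (0 < m)%N by lia.
have s0 := sin_mode_angle_gt0 _ _ jm : 0 < sin (angle m j).
rewrite normf_div (gtr0_norm s0) ler_pdivrMr//.
rewrite (le_trans (cos_max _))//.
have E : `|sin (m%:R * angle m j)| = 1.
  rewrite /angle (_ : m%:R * _ = pi / 2 + j%:R * pi); last first.
    rewrite -muln2 -natr1 -!muln2 !natrM; field.
    by rewrite pnatr_eq0 -lt0n.
  rewrite mulr_natl (alternatingn (@sinDpi R)) sin_pihalf mulr1.
  by rewrite normrX normrN1 expr1n.
by rewrite -[leLHS]E (le_trans (norm_sin_natmul _ _ _))// gtr0_norm.
Qed.

Lemma mode_angle0 m : angle m 0 = pi / m.*2%:R.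
Proof. by rewrite /mode_angle mul1r. Qed.

Lemma double_mode_angle_pi m j : (0 < m)%N ->
  2 * angle m j = j.*2.+1%:R * (pi / m%:R).
Proof.
by move=> m0; rewrite -[2]/(1.*2%:R) double_mode_angle// mul1r.
Qed.

Lemma mode_angle_rev m j : (j < m)%N -> angle m (m - j.+1) = pi - angle m j.
Proof.
move=> jm; have m0 : (0 < m)%N by lia.
rewrite /angle (_ : (m - j.+1).*2.+1 = m.*2 - j.*2.+1)%N; last by lia.
rewrite natrB; last by lia.
by rewrite mulrBl (mulrCA m.*2%:R) divff ?mulr1// pnatr_eq0 double_eq0 -lt0n.
Qed.

(* The factor [cos ^+ t] is small unless the eigenvalue is close to -1, which
   happens for the frequencies m - 1, m and m + 1, where the cotangent is small. *)
Lemma mode_bound m t j : (4 <= m)%N -> (0 < j < m.-1)%N ->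
  `|cos (angle m j) / sin (angle m j)| * `|cos (2 * angle m j)| ^+ t <=
  m%:R * cos (2 * (pi / m%:R)) ^+ t
  + sin (pi / m.*2%:R) / cos (pi / m.*2%:R) * cos (pi / m%:R) ^+ t.
Proof.
move=> m4.
have m0 : (0 < m)%N by lia.
have q0 : 0 < pi / m.*2%:R :> R by rewrite divr_gt0 ?pi_gt0// ltr0n double_gt0.
have q1 : pi / m.*2%:R < pi / 2 :> R.
  by rewrite ltr_pM2l ?pi_gt0// ltf_pV2 ?posrE ?ltr0n ?double_gt0// ltr_nat; lia.
have sq0 : 0 < sin (pi / m.*2%:R) :> R by apply: sin_gt0_pihalf; rewrite q0 q1.
have cq0 : 0 < cos (pi / m.*2%:R) :> R.
  by apply: cos_gt0_pihalf; rewrite q1 (lt_trans _ q0)// oppr_lt0 divr_gt0 ?pi_gt0.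
have c20 : 0 <= cos (2 * (pi / m%:R)) :> R.
  apply: cos_ge0_pihalf; rewrite (@le_trans _ _ 0) ?oppr_le0 ?mulr_ge0 ?invr_ge0 ?pi_ge0 ?ler0n//=.
  rewrite mulrCA ler_pM2l ?pi_gt0// ler_pdivrMr ?ltr0n//.
  by rewrite mulrC ler_pdivlMr// -natrM ler_nat; lia.
have c10 : 0 <= cos (pi / m%:R) :> R.
  apply: cos_ge0_pihalf; rewrite (@le_trans _ _ 0) ?oppr_le0 ?mulr_ge0 ?invr_ge0 ?pi_ge0 ?ler0n//=.
  by rewrite ler_pM2l ?pi_gt0// lef_pV2 ?posrE ?ltr0n// ler_nat; lia.
(* The reflection [j -> m - 1 - j] only changes the sign of the cotangent and keeps the eigenvalue,
   so the frequency may be taken at most [pi]. *)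
wlog jm : j / (j.*2.+1 <= m)%N.
  move=> W /andP[j0 jm]; have [|jm'] := leqP j.*2.+1 m.
    by move=> /W; apply; rewrite j0 jm.
  have /W : ((m - j.+1).*2.+1 <= m)%N by lia.
  have /[swap]/[apply] : (0 < m - j.+1 < m.-1)%N by lia.
  rewrite mode_angle_rev; last by lia.
  rewrite addrC sinDpi cosDpi mulrDr mulrN sinN cosN opprK normf_div normrN -normf_div.
  rewrite (_ : - (2 * angle m j) + 2 * pi = - (2 * angle m j) + pi + pi); last by ring.
  by rewrite !cosDpi opprK cosN.
move=> /andP[j0 _].
have s0 : 0 < sin (angle m j) by apply: sin_mode_angle_gt0; lia.
(* Away from [pi]: since [j > 0], the numerator [2j+1] lies between 2 and [m - 2], and the first
   summand of the bound suffices. *)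
have [jm2|jm2] := leqP j.*2.+1 (m - 2).
  apply: ler_wpDr; first by rewrite mulr_ge0 ?exprn_ge0 ?divr_ge0 ?(ltW sq0) ?(ltW cq0).
  apply: ler_pM; rewrite ?exprn_ge0//.
    by apply: norm_cot_mode_angle; lia.
  apply: lerXn2r; rewrite ?nnegrE// double_mode_angle_pi//.
  by apply: norm_cos_pi_frac => //; lia.
(* Two cases remain: [2j+1 = m], where the cotangent vanishes, and [2j+1 = m - 1], where it equals
   [tan(pi / 2m)]. *)
apply: ler_wpDl; first by rewrite mulr_ge0 ?exprn_ge0 ?ler0n.
have [jE|jE] := eqVneq j.*2.+1 m.
  have -> : angle m j = pi / 2.
    rewrite /angle jE -muln2 natrM; field.
    by rewrite pnatr_eq0 -lt0n.
  by rewrite cos_pihalf mul0r normr0 mul0r mulr_ge0 ?exprn_ge0 ?divr_ge0 ?(ltW sq0) ?(ltW cq0).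
have aE : angle m j = - (pi / m.*2%:R) + pi / 2.
  rewrite /angle (_ : j.*2.+1 = m - 1)%N; last by lia.
  rewrite natrB// -muln2 natrM; field.
  by rewrite pnatr_eq0 -lt0n.
rewrite [X in `|X / _|](_ : _ = sin (pi / m.*2%:R)); last first.
  by rewrite aE cosDpihalf sinN opprK.
rewrite [X in `|_ / X|](_ : _ = cos (pi / m.*2%:R)); last first.
  by rewrite aE sinDpihalf cosN.
rewrite gtr0_norm ?divr_gt0// ler_pM2l ?divr_gt0//.
apply: lerXn2r; rewrite ?nnegrE// double_mode_angle_pi//.
by have := norm_cos_pi_frac R 1 j.*2.+1 m m0; rewrite mul1r; apply; lia.
Qed.

(** The modes [0] and [m - 1] coincide and give the leading term, with its factor 2. Each other
    mode, divided by the leading eigenvalue to the power [t], is bounded through [mode_bound]: a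
    cotangent at most [m] times a decay [m^4 / (2t^2)], plus the tangent left by eigenvalues near
    -1. *)
Lemma survival_bound m x t : (4 <= m)%N -> (0 < t)%N ->
  `|survival m x t / cos (pi / m%:R) ^+ t
    - 2 / m%:R * (cos (pi / m.*2%:R) / sin (pi / m.*2%:R)) * sin (x%:R * pi / m%:R)|
  <= m%:R ^+ 5 / (2 * t%:R ^+ 2) + sin (pi / m.*2%:R) / cos (pi / m.*2%:R) :> R.
Proof.
move=> m4 t0; have m0 : (0 < m)%N by lia.
have mR0 : 0 < m%:R :> R by rewrite ltr0n.
have tR0 : 0 < t%:R :> R by rewrite ltr0n.
have c10 : 0 < cos (pi / m%:R) :> R.
  apply: cos_gt0_pihalf; apply/andP; split.
    by rewrite (@lt_trans _ _ 0) ?oppr_lt0 ?divr_gt0 ?pi_gt0.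
  by rewrite ltr_pM2l ?pi_gt0// ltf_pV2 ?posrE ?ltr0n// ltr_nat; lia.
set lam := cos (pi / m%:R) : R in c10 *.
pose term j : R := cos (angle m j) / sin (angle m j) *
    sin (x.*2%:R * angle m j) * cos (2 * angle m j) ^+ t.
have E0 : term 0%N = cos (pi / m.*2%:R) / sin (pi / m.*2%:R) * sin (x%:R * pi / m%:R) * lam ^+ t.
  by rewrite /term double_mode_angle// double_mode_angle_pi// mode_angle0 !mul1r.
have E1 : term m.-1 = term 0%N.
  rewrite /term -subn1 mode_angle_rev//.
  have -> (a : R) : x.*2%:R * (pi - a) = - (x.*2%:R * a) + x.*2%:R * pi by ring.
  have -> (a : R) : 2 * (pi - a) = - (2 * a) + pi + pi by ring.
  have -> (a : R) : sin (- a + x.*2%:R * pi) = - sin a.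
    rewrite mulr_natl (alternatingn (@sinDpi R)) -signr_odd odd_double mul1r.
    by rewrite sinN.
  rewrite addrC sinDpi (cosDpi (- angle m 0)) !cosDpi !cosN !sinN !opprK.
  by rewrite (mulNr (cos _)) mulrNN.
have lam1 : lam <= 1 by apply: cos_le1.
have lamE : lam = 1 - 2 * sin (pi / m.*2%:R) ^+ 2.
  have -> : lam = cos (pi / m.*2%:R *+ 2).
    congr cos; rewrite -muln2 natrM; field; exact: lt0r_neq0.
  by rewrite cos_mulr2n cos2sin2; ring.
have sm : m%:R^-1 <= sin (pi / m.*2%:R) :> R.
  have q0 : 0 < pi / m.*2%:R :> R by rewrite divr_gt0 ?pi_gt0// ltr0n double_gt0.
  have sq0 : 0 <= sin (pi / m.*2%:R) :> R.
    apply/ltW/sin_gt0_pihalf; rewrite q0/=.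
    by rewrite ltr_pM2l ?pi_gt0// ltf_pV2 ?posrE ?ltr0n ?double_gt0// ltr_nat; lia.
  rewrite -[leRHS]ger0_norm// -[leLHS]mul1r ler_pdivrMr// mulrC.
  apply: le_trans (norm_sin_natmul _ _ _).
  rewrite (_ : m%:R * _ = pi / 2) ?sin_pihalf ?normr1//.
  by rewrite -muln2 natrM; field; exact: lt0r_neq0.
(* [lam <= 1 - 2/m^2 <= exp(-2/m^2)], then [expR_decay] at [2t/m^2]. *)
have lam_decay : lam ^+ t <= m%:R ^+ 4 / (2 * t%:R ^+ 2).
  have -> : m%:R ^+ 4 / (2 * t%:R ^+ 2) = 2 / (t%:R * (2 / m%:R ^+ 2)) ^+ 2 :> R.
    by field; rewrite !lt0r_neq0.
  rewrite (le_trans _ (expR_decay _ _ _))//; last first.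
    by rewrite mulr_gt0// divr_gt0// exprn_gt0.
  rewrite -mulrN expRM_natl lerXn2r ?nnegrE ?expR_ge0 ?(ltW c10)//.
  rewrite (le_trans _ (expR_ge1Dx _))// lamE lerD2l lerN2 ler_pM2l//.
  rewrite -exprVn lerXn2r ?nnegrE ?invr_ge0 ?ler0n//.
  by rewrite (le_trans _ sm)// invr_ge0.
(* [cos(2v) = 2 cos(v)^2 - 1 <= cos(v)^2]: after division by [lam ^+ t] a whole factor [lam ^+ t] is
   left to decay. *)
have lam2 : cos (2 * (pi / m%:R)) <= lam * lam.
  rewrite mulr_natl cos_mulr2n -/lam -expr2 mulr2n lerBlDr lerD2l.
  by rewrite expr_le1// ltW.
have lam2t : cos (2 * (pi / m%:R)) ^+ t <= lam ^+ t * lam ^+ t.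
  rewrite -exprMn lerXn2r ?nnegrE ?mulr_ge0 ?(ltW c10)//.
  apply: cos_ge0_pihalf; rewrite (@le_trans _ _ 0) ?oppr_le0 ?mulr_ge0 ?invr_ge0 ?pi_ge0 ?ler0n//=.
  rewrite mulrCA ler_pM2l ?pi_gt0// ler_pdivrMr//.
  by rewrite mulrC ler_pdivlMr// -natrM ler_nat; lia.
have lamt0 : 0 < lam ^+ t by rewrite exprn_gt0.
have splitS : \sum_(j < m) term j = term 0%N *+ 2 + \sum_(1 <= j < m.-1) term j.
  rewrite -(big_mkord xpredT term) big_ltn// (@big_cat_nat _ _ _ m.-1)/=; [|lia|lia].
  rewrite (_ : \sum_(m.-1 <= i < m) _ = term m.-1); last first.
    by rewrite /index_iota (_ : (m - m.-1)%N = 1%N) ?big_seq1//; lia.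
  by rewrite E1 mulr2n (addrC (\sum_(_ <= _ < _) _)) addrA.
have -> : survival m x t / lam ^+ t - 2 / m%:R * (cos (pi / m.*2%:R) / sin (pi / m.*2%:R)) * sin (x%:R * pi / m%:R)
    = (\sum_(1 <= j < m.-1) term j) / (m%:R * lam ^+ t).
  rewrite /survival -/(term _) splitS E0.
  move: (\sum_(1 <= j < m.-1) term j) (cos (pi / m.*2%:R) / sin (pi / m.*2%:R))
    (sin (x%:R * pi / m%:R)) (lam ^+ t) lamt0 => S C s l l0.
  by rewrite -mulr_natl; field; rewrite !lt0r_neq0.
rewrite normrM normfV (gtr0_norm (mulr_gt0 mR0 lamt0)) ler_pdivrMr ?mulr_gt0//.
rewrite (le_trans (ler_norm_sum _ _ _))//.
set B := (X in _ <= X * _).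
(* There are fewer than [m] terms, which the prefactor [1/m] absorbs. *)
apply: (@le_trans _ _ (\sum_(1 <= j < m.-1) (B * lam ^+ t))); last first.
  rewrite sumr_const_nat -[leLHS]mulr_natr -[leLHS]mulrA (mulrC m%:R) ler_wpM2l//.
    rewrite addr_ge0 ?divr_ge0 ?mulr_ge0 ?exprn_ge0 ?ler0n//.
      by rewrite (le_trans _ sm)// invr_ge0.
    apply: cos_ge0_pihalf; rewrite (@le_trans _ _ 0) ?oppr_le0 ?divr_ge0 ?pi_ge0//=.
    by rewrite ler_pM2l ?pi_gt0// lef_pV2 ?posrE ?ltr0n ?double_gt0// ler_nat; lia.
  by rewrite ler_wpM2l ?(ltW lamt0)// ler_nat; lia.
rewrite big_nat_cond [leRHS]big_nat_cond; apply: ler_sum => j; rewrite andbT => jm.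
rewrite /term normrM normrX normrM (le_trans (y := `|cos (angle m j) / sin (angle m j)| * `|cos (2 * angle m j)| ^+ t))//.
  by rewrite ler_wpM2r ?exprn_ge0// ler_piMr// sin_max.
rewrite (le_trans (mode_bound _ t _ m4 jm))// /B [leRHS]mulrDl lerD2r.
have -> : m%:R ^+ 5 / (2 * t%:R ^+ 2) * lam ^+ t =
    m%:R * (m%:R ^+ 4 / (2 * t%:R ^+ 2) * lam ^+ t) by rewrite exprS !mulrA.
rewrite ler_wpM2l ?ler0n// (le_trans lam2t)//.
by rewrite ler_wpM2r ?(ltW lamt0).
Qed.

End survival_bound.

(** * Asymptotics of the survival probability *)

Section asymptotics.
Context {R : realType}.

Lemma cvg_continuous_seq (u : nat -> R) (h : R -> R) (a l : R) :
  {for a, continuous h} -> h a = l -> u n @[n --> \oo] --> a ->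
  h (u n) @[n --> \oo] --> l.
Proof. by move=> hc <-; apply: continuous_cvg. Qed.

Lemma cvg_sub0_trans (u v : nat -> R) (l : R) :
  u n - v n @[n --> \oo] --> (0 : R) -> v n @[n --> \oo] --> l ->
  u n @[n --> \oo] --> l.
Proof.
move=> uv vl; rewrite -[l]add0r (_ : u = fun n => (u n - v n) + v n).
  exact: cvgD.
by apply/funext => n; rewrite subrK.
Qed.

(** Continuity at 0 is the derivative of sine there. The factorization holds at 0 too, so sines of
    vanishing angles can be replaced by products without case distinction. *)
Lemma sinc_exists : exists g : R -> R,
  [/\ {for 0, continuous g}, g 0 = 1 & forall x, sin x = x * g x].
Proof.
exists (fun x => if x == 0 then 1 else sin x / x); split.
- apply/continuous_withinNx; rewrite eqxx.
  have [ds es] := is_derive_sin (0 : R).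
  have := ds; rewrite /derivable => /cvg_ex[l hl].
  have l1 : l = 1.
    by move: es; rewrite cos0 /derive => <-; apply/esym/cvg_lim.
  rewrite -l1; apply: cvg_trans hl; apply: near_eq_cvg; near=> h => /=.
  have h0 : h != 0 by near: h; exact: nbhs_dnbhs_neq.
  by rewrite (negbTE h0) addr0 sin0 subr0 /= [LHS]mulrC [h%:A]mulr1.
- by rewrite eqxx.
- by move=> x; case: eqP => [->|/eqP x0]; rewrite ?sin0 ?mul0r// mulrC divfK.
Unshelve. all: by end_near. Qed.

Lemma cvg_invn : (n%:R^-1 : R) @[n --> \oo] --> (0 : R).
Proof.
apply/gtr0_cvgV0; last exact: cvgr_idn.
by near=> n; rewrite ltr0n; near: n; exact: nbhs_infty_gt.
Unshelve. all: by end_near. Qed.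

Lemma cvg_subn_div (c : nat) : ((n - c)%:R / n%:R : R) @[n --> \oo] --> (1 : R).
Proof.
have : 1 - c%:R * n%:R^-1 @[n --> \oo] --> (1 - c%:R * 0 : R).
  by apply: cvgB; [exact: cvg_cst|apply: cvgM; [exact: cvg_cst|exact: cvg_invn]].
rewrite mulr0 subr0; apply: cvg_trans; apply: near_eq_cvg; near=> n.
have n0 : (0 < n)%N by near: n; exact: nbhs_infty_gt.
have cn : (c <= n)%N by near: n; exact: nbhs_infty_ge.
by rewrite natrB// mulrBl divff// pnatr_eq0 -lt0n.
Unshelve. all: by end_near. Qed.

Lemma cvg_div_subn (c : nat) : (n%:R / (n - c)%:R : R) @[n --> \oo] --> (1 : R).
Proof.
rewrite -[X in _ --> X]invr1; under eq_cvg do rewrite -invf_div.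
by apply: cvgV; [exact: oner_neq0|exact: cvg_subn_div].
Qed.

Lemma cvg_half_subn_div (b c : nat) :
  ((n./2 - b)%:R / (n - c)%:R : R) @[n --> \oo] --> (2^-1 : R).
Proof.
have half : (n./2%:R / n%:R : R) @[n --> \oo] --> (2^-1 : R).
  apply: (@squeeze_cvgr _ _ _ _ (fun n => 2^-1 - n%:R^-1) (fun=> 2^-1)).
  - near=> n.
    have n0 : 0 < n%:R :> R by rewrite ltr0n; near: n; exact: nbhs_infty_gt.
    have nE : (n%:R = (odd n)%:R + 2 * n./2%:R :> R).
      by rewrite -natrM -natrD mul2n odd_double_half.
    rewrite ler_pdivlMr// ler_pdivrMr// mulrBl mulVf ?lt0r_neq0//.
    by rewrite nE; case: (odd n) => /=; lra.
  - rewrite -[X in _ --> X]subr0; apply: cvgB; [exact: cvg_cst|exact: cvg_invn].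
  - exact: cvg_cst.
have : (n./2%:R / n%:R - b%:R * n%:R^-1) * (n%:R / (n - c)%:R) @[n --> \oo]
    --> ((2^-1 - b%:R * 0) * 1 : R).
  apply: cvgM; last exact: cvg_div_subn.
  by apply: cvgB => //; apply: cvgM; [exact: cvg_cst|exact: cvg_invn].
rewrite mulr0 subr0 mulr1; apply: cvg_trans; apply: near_eq_cvg; near=> n.
have n0 : (0 < n)%N by near: n; exact: nbhs_infty_gt.
have bn : (b <= n./2)%N.
  have : (b.*2 <= n)%N by near: n; exact: nbhs_infty_ge.
  by lia.
rewrite -mulrBl -(natrB _ bn) mulrA; congr (_ / _).
by rewrite divfK// pnatr_eq0 -lt0n.
Unshelve. all: by end_near. Qed.

Lemma cvg_time_horizon (alpha : R) : 0 < alpha ->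
  (time_horizon alpha n)%:R / n%:R ^+ 3 @[n --> \oo] --> (alpha / (2 * pi ^+ 2) : R).
Proof.
move=> a0.
have p0 : 0 < 2 * pi ^+ 2 :> R by rewrite mulr_gt0// exprn_gt0// pi_gt0.
apply: (@squeeze_cvgr _ _ _ _ (fun n => alpha / (2 * pi ^+ 2) - n%:R^-1)
  (fun=> alpha / (2 * pi ^+ 2))).
- near=> n.
  have n0 : 0 < n%:R :> R by rewrite ltr0n; near: n; exact: nbhs_infty_gt.
  have n1 : 1 <= n%:R :> R by rewrite ler1n; near: n; exact: nbhs_infty_gt.
  have x0 : 0 <= alpha * n%:R ^+ 3 / (2 * pi ^+ 2).
    by rewrite divr_ge0 ?(ltW p0)// mulr_ge0 ?exprn_ge0 ?ler0n ?(ltW a0).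
  have /andP[t1 t2] := truncn_itv x0.
  rewrite ler_pdivlMr ?exprn_gt0// ler_pdivrMr ?exprn_gt0//.
  rewrite (_ : alpha / (2 * pi ^+ 2) * n%:R ^+ 3 = alpha * n%:R ^+ 3 / (2 * pi ^+ 2)); last first.
    by rewrite mulrAC.
  rewrite t1 andbT mulrBl [alpha / _ * _]mulrAC lerBlDr.
  (* Truncation loses at most 1, and [1 <= n^2 = n^3 / n]. *)
  rewrite (le_trans (ltW t2))// -natr1 lerD2l exprS mulrA mulVf ?lt0r_neq0// mul1r.
  by rewrite exprn_ege1.
- rewrite -[X in _ --> X]subr0; apply: cvgB; [exact: cvg_cst|exact: cvg_invn].
- exact: cvg_cst.
Unshelve. all: by end_near. Qed.

Lemma cvg_inv_subn (c : nat) : ((n - c)%:R^-1 : R) @[n --> \oo] --> (0 : R).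
Proof.
have : (n%:R / (n - c)%:R : R) * n%:R^-1 @[n --> \oo] --> (1 * 0 : R).
  by apply: cvgM; [exact: cvg_div_subn|exact: cvg_invn].
rewrite mulr0; apply: cvg_trans; apply: near_eq_cvg; near=> n.
have n0 : (0 < n)%N by near: n; exact: nbhs_infty_gt.
by rewrite mulrAC divff ?mul1r// pnatr_eq0 -lt0n.
Unshelve. all: by end_near. Qed.

Lemma cvg_eigenvalue (c : nat) : cos (pi / (n - c)%:R : R) @[n --> \oo] --> (1 : R).
Proof.
apply: (cvg_continuous_seq _ _ 0 _ (@continuous_cos R _) (@cos0 R)).
rewrite -[X in _ --> X](mulr0 pi).
by apply: cvgM; [exact: cvg_cst|exact: cvg_inv_subn].
Qed.

(** With [m = n - c], the leading term is about [(2/m) (2m/pi)] times a sine tending to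
    [sin(pi/2) = 1], as the walk starts near the middle. The error in [survival_bound] is of order
    [n^5 / n^6] plus [tan(pi / 2m)]. *)
Lemma cvg_survival (alpha : R) (b c : nat) : 0 < alpha ->
  survival (n - c) (n./2 - b) (time_horizon alpha n)
    / cos (pi / (n - c)%:R) ^+ time_horizon alpha n @[n --> \oo] --> (4 / pi : R).
Proof.
move=> a0.
have [g [g0 g1 gE]] := sinc_exists.
have cth : (pi / (n - c).*2%:R : R) @[n --> \oo] --> (0 : R).
  have : (pi / 2 * (n - c)%:R^-1 : R) @[n --> \oo] --> (pi / 2 * 0 : R).
    by apply: cvgM; [exact: cvg_cst|exact: cvg_inv_subn].
  rewrite mulr0; under eq_cvg do rewrite -mulrA -invfM -natrM mul2n.
  exact.
have cc : cos (pi / (n - c).*2%:R : R) @[n --> \oo] --> (1 : R).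
  exact: (cvg_continuous_seq _ _ _ _ (@continuous_cos R _) (@cos0 R) cth).
have cs : sin (pi / (n - c).*2%:R : R) @[n --> \oo] --> (0 : R).
  exact: (cvg_continuous_seq _ _ _ _ (@continuous_sin R _) (@sin0 R) cth).
have cg : g (pi / (n - c).*2%:R : R) @[n --> \oo] --> (1 : R).
  exact: (cvg_continuous_seq _ _ _ _ g0 g1 cth).
have cx : sin ((n./2 - b)%:R * pi / (n - c)%:R : R) @[n --> \oo] --> (1 : R).
  have : ((n./2 - b)%:R / (n - c)%:R * pi : R) @[n --> \oo] --> (2^-1 * pi : R).
    by apply: cvgM; [exact: cvg_half_subn_div|exact: cvg_cst].
  under eq_cvg do rewrite mulrAC.
  rewrite (mulrC 2^-1) => h.
  exact: (cvg_continuous_seq _ _ _ _ (@continuous_sin R _) (@sin_pihalf R) h).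
have clead : 2 / (n - c)%:R * (cos (pi / (n - c).*2%:R) / sin (pi / (n - c).*2%:R))
    * sin ((n./2 - b)%:R * pi / (n - c)%:R) @[n --> \oo] --> (4 / pi : R).
  have : 4 / pi * cos (pi / (n - c).*2%:R) * (g (pi / (n - c).*2%:R))^-1
      * sin ((n./2 - b)%:R * pi / (n - c)%:R) @[n --> \oo] --> (4 / pi * 1 * 1^-1 * 1 : R).
    apply: cvgM => //; apply: cvgM; last by apply: cvgV => //; exact: oner_neq0.
    by apply: cvgM => //; exact: cvg_cst.
  rewrite invr1 !mulr1; apply: cvg_trans; apply: near_eq_cvg; near=> n.
  have nc : (c < n)%N by near: n; exact: nbhs_infty_gt.
  congr (_ * _); rewrite gE -muln2 natrM.
  have : g (pi / ((n - c)%:R * 2)) != 0.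
    rewrite -natrM muln2; near: n.
    by apply: (cvgr_neq0 _ cg); exact: oner_neq0.
  have m0 : (n - c)%:R != 0 :> R by rewrite pnatr_eq0 subn_eq0 -ltnNge.
  move: (@pi R) (lt0r_neq0 (pi_gt0 R)) (g _) (cos _) => p p0 u v u0; field.
  by rewrite u0 p0 m0.
have ct := cvg_time_horizon alpha a0.
have lim0 : alpha / (2 * pi ^+ 2) != 0.
  by rewrite lt0r_neq0// divr_gt0// mulr_gt0// exprn_gt0// pi_gt0.
have cerr : (n - c)%:R ^+ 5 / (2 * (time_horizon alpha n)%:R ^+ 2)
    + sin (pi / (n - c).*2%:R) / cos (pi / (n - c).*2%:R) @[n --> \oo] --> (0 : R).
  rewrite -[X in _ --> X](addr0 0); apply: cvgD; last first.
    rewrite -[X in _ --> X](mul0r (1^-1)); apply: cvgM => //.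
    by apply: cvgV => //; exact: oner_neq0.
  (* The first error term is split into convergent ratios and a leftover [1/n]. *)
  have : ((n - c)%:R / n%:R) ^+ 5 * (2 * ((time_horizon alpha n)%:R / n%:R ^+ 3) ^+ 2)^-1 * n%:R^-1
      @[n --> \oo] --> (1 ^+ 5 * (2 * (alpha / (2 * pi ^+ 2)) ^+ 2)^-1 * 0 : R).
    apply: cvgM; last exact: cvg_invn.
    apply: cvgM.
      exact: (cvg_continuous_seq _ _ _ _ (@exprn_continuous R _ _) erefl (cvg_subn_div c)).
    apply: cvgV.
      by rewrite mulf_neq0// expf_neq0.
    apply: cvgM; first exact: cvg_cst.
    exact: (cvg_continuous_seq _ _ _ _ (@exprn_continuous R _ _) erefl ct).
  rewrite mulr0; apply: cvg_trans; apply: near_eq_cvg; near=> n.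
  have n0 : (0 < n)%N by near: n; exact: nbhs_infty_gt.
  have : (time_horizon alpha n)%:R / n%:R ^+ 3 != 0 :> R.
    near: n; exact: (cvgr_neq0 _ ct lim0).
  rewrite mulf_eq0 negb_or => /andP[t0 _].
  have : n%:R != 0 :> R by rewrite pnatr_eq0 -lt0n.
  move: (time_horizon _ _)%:R t0 (n - c)%:R n%:R => t t0 m k k0; field.
  by rewrite t0 k0.
suff h0 : survival (n - c) (n./2 - b) (time_horizon alpha n)
    / cos (pi / (n - c)%:R) ^+ time_horizon alpha n
    - 2 / (n - c)%:R * (cos (pi / (n - c).*2%:R) / sin (pi / (n - c).*2%:R))
    * sin ((n./2 - b)%:R * pi / (n - c)%:R) @[n --> \oo] --> (0 : R).
  exact: (cvg_sub0_trans _ _ _ h0 clead).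
apply: (squeeze_cvgr _ _ cerr); last first.
  by rewrite -[X in _ --> X]oppr0; exact: (cvgN cerr).
near=> n; rewrite -ler_norml.
have cn : (c + 4 <= n)%N by near: n; exact: nbhs_infty_ge.
have : (time_horizon alpha n)%:R / n%:R ^+ 3 != 0 :> R.
  near: n; exact: (cvgr_neq0 _ ct lim0).
rewrite mulf_eq0 negb_or pnatr_eq0 -lt0n => /andP[t0 _].
by apply: survival_bound => //; lia.
Unshelve. all: by end_near. Qed.

(** Squeeze between [exp(-t delta / (1 - delta))] and [exp(-t delta)]: apply [1 + y <= e^y] at
    [y = delta / (1 - delta)] and at [y = -delta]. *)
Lemma cvg_expn_1sub (delta : nat -> R) (t : nat -> nat) (l : R) :
  delta n @[n --> \oo] --> (0 : R) ->
  (t n)%:R * delta n @[n --> \oo] --> l ->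
  (1 - delta n) ^+ t n @[n --> \oo] --> expR (- l).
Proof.
move=> d0 tdl.
have lt1 : \forall n \near \oo, delta n < 1.
  by apply: (cvgr_lt _ d0); exact: ltr01.
have tdl' : (t n)%:R * delta n / (1 - delta n) @[n --> \oo] --> l.
  rewrite (_ : l = l * 1^-1); last by rewrite invr1 mulr1.
  apply: cvgM => //.
  apply: cvgV; first exact: oner_neq0.
  by rewrite -[X in _ --> X]subr0; apply: cvgB => //; exact: cvg_cst.
have expcvg (u : nat -> R) : u n @[n --> \oo] --> l ->
    expR (- u n) @[n --> \oo] --> expR (- l).
  move=> ul; apply: (cvg_continuous_seq _ _ _ _ (@continuous_expR R _) erefl).
  exact: cvgN.
apply: (squeeze_cvgr _ (expcvg _ tdl') (expcvg _ tdl)).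
near=> n.
have dn : 0 < 1 - delta n by rewrite subr_gt0; near: n.
rewrite -!(mulrA (t n)%:R) -!(mulrN (t n)%:R) !expRM_natl; apply/andP; split.
  apply: lerXn2r; rewrite ?nnegrE ?expR_ge0 ?(ltW dn)//.
  rewrite expRN -[leRHS]invrK lef_pV2 ?posrE ?expR_gt0 ?invr_gt0//.
  rewrite (le_trans _ (expR_ge1Dx _))//.
  rewrite [leRHS](_ : _ = (1 - delta n)^-1)//.
  by field; exact: lt0r_neq0.
apply: lerXn2r; rewrite ?nnegrE ?expR_ge0 ?(ltW dn)//.
exact: expR_ge1Dx.
Unshelve. all: by end_near. Qed.

(** With [s] and [d] the half-sum and half-difference of the two angles, [cos(s + d) = cos(s - d) -
    2 sin(s) sin(d)], so the ratio is [1 - delta]. Here [s] is about [pi / n] and [d] about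
    [pi c / (2n^2)], so [delta] is about [pi^2 c / n^3] and [t delta] tends to [alpha c / 2]. *)
Lemma cvg_eigenvalue_ratio (alpha : R) (c : nat) : 0 < alpha ->
  (cos (pi / (n - c)%:R) / cos (pi / n%:R)) ^+ time_horizon alpha n @[n --> \oo]
    --> expR (- (alpha / 2 * c%:R)).
Proof.
move=> a0.
have [g [g0 g1 gE]] := sinc_exists.
pose s n : R := (pi / n%:R + pi / (n - c)%:R) / 2.
pose d n : R := (pi / (n - c)%:R - pi / n%:R) / 2.
have cA : (pi / n%:R : R) @[n --> \oo] --> (0 : R).
  rewrite -[X in _ --> X](mulr0 pi); apply: cvgM; [exact: cvg_cst|exact: cvg_invn].
have cB : (pi / (n - c)%:R : R) @[n --> \oo] --> (0 : R).
  rewrite -[X in _ --> X](mulr0 pi); apply: cvgM; [exact: cvg_cst|exact: cvg_inv_subn].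
have cs : s n @[n --> \oo] --> (0 : R).
  rewrite (_ : 0 = (0 + 0) / 2); last by rewrite addr0 mul0r.
  by apply: cvgM; [exact: cvgD|exact: cvg_cst].
have cd : d n @[n --> \oo] --> (0 : R).
  rewrite (_ : 0 = (0 - 0) / 2); last by rewrite subr0 mul0r.
  by apply: cvgM; [exact: cvgB|exact: cvg_cst].
have ccA : cos (pi / n%:R : R) @[n --> \oo] --> (1 : R).
  by have := cvg_eigenvalue 0; under eq_cvg do rewrite subn0.
have css : sin (s n) @[n --> \oo] --> (0 : R).
  exact: (cvg_continuous_seq _ _ _ _ (@continuous_sin R _) (@sin0 R) cs).
have csd : sin (d n) @[n --> \oo] --> (0 : R).
  exact: (cvg_continuous_seq _ _ _ _ (@continuous_sin R _) (@sin0 R) cd).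
pose delta n : R := 2 * sin (s n) * sin (d n) / cos (pi / n%:R).
have cA0 : \forall n \near \oo, cos (pi / n%:R) != 0 :> R.
  by apply: (cvgr_neq0 _ ccA); exact: oner_neq0.
have : (1 - delta n) ^+ time_horizon alpha n @[n --> \oo]
    --> expR (- (alpha / 2 * c%:R)).
  apply: cvg_expn_1sub.
    rewrite (_ : 0 = 2 * 0 * 0 / 1); last by rewrite mulr0 mul0r.
    apply: cvgM; last by apply: cvgV => //; exact: oner_neq0.
    by apply: cvgM => //; apply: cvgM => //; exact: cvg_cst.
  have cns : n%:R * s n @[n --> \oo] --> (pi : R).
    have : pi / 2 * (1 + n%:R / (n - c)%:R) @[n --> \oo] --> (pi / 2 * (1 + 1) : R).
      apply: cvgM; first exact: cvg_cst.
      by apply: cvgD; [exact: cvg_cst|exact: cvg_div_subn].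
    rewrite (_ : pi / 2 * (1 + 1) = pi); last by rewrite divfK.
    apply: cvg_trans; apply: near_eq_cvg; near=> n.
    have : n%:R != 0 :> R by rewrite pnatr_eq0 -lt0n; near: n; exact: nbhs_infty_gt.
    have : (n - c)%:R != 0 :> R.
      by rewrite pnatr_eq0 subn_eq0 -ltnNge; near: n; exact: nbhs_infty_gt.
    rewrite /s; move: (@pi R) n%:R (n - c)%:R => p k m m0 k0; field.
    by rewrite k0 m0.
  have cnd : n%:R ^+ 2 * d n @[n --> \oo] --> (pi / 2 * c%:R : R).
    have : pi / 2 * c%:R * (n%:R / (n - c)%:R) @[n --> \oo] --> (pi / 2 * c%:R * 1 : R).
      by apply: cvgM; [exact: cvg_cst|exact: cvg_div_subn].
    rewrite mulr1; apply: cvg_trans; apply: near_eq_cvg; near=> n.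
    have cn : (c < n)%N by near: n; exact: nbhs_infty_gt.
    have : n%:R != 0 :> R by rewrite pnatr_eq0 -lt0n; near: n; exact: nbhs_infty_gt.
    have : (n - c)%:R != 0 :> R by rewrite pnatr_eq0 subn_eq0 -ltnNge.
    rewrite /d natrB 1?ltnW//; move: (@pi R) n%:R c%:R => p k m m0 k0; field.
    by rewrite k0 m0.
  (* The factor [n^3] is shared out: [n] goes to [s] and [n^2] to [d]. *)
  have : (time_horizon alpha n)%:R / n%:R ^+ 3 *
      (2 * (n%:R * s n) * (n%:R ^+ 2 * d n) * g (s n) * g (d n) / cos (pi / n%:R)) @[n --> \oo]
      --> alpha / (2 * pi ^+ 2) * (2 * pi * (pi / 2 * c%:R) * 1 * 1 / 1).
    apply: cvgM; first exact: cvg_time_horizon.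
    apply: cvgM; last by apply: cvgV => //; exact: oner_neq0.
    apply: cvgM; last exact: (cvg_continuous_seq _ _ _ _ g0 g1 cd).
    apply: cvgM; last exact: (cvg_continuous_seq _ _ _ _ g0 g1 cs).
    apply: cvgM => //; apply: cvgM => //; exact: cvg_cst.
  rewrite (_ : alpha / (2 * pi ^+ 2) * _ = alpha / 2 * c%:R); last first.
    by move: (@pi R) (lt0r_neq0 (pi_gt0 R)) => p p0; field.
  apply: cvg_trans; apply: near_eq_cvg; near=> n.
  have k0 : n%:R != 0 :> R by rewrite pnatr_eq0 -lt0n; near: n; exact: nbhs_infty_gt.
  have : cos (pi / n%:R) != 0 :> R by near: n.
  rewrite /delta !gE; move: n%:R k0 (time_horizon _ _)%:R (s n) (d n) (g _) (g _) (cos _) => k k0 w u v x y C C0.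
  by field; rewrite k0 C0.
apply: cvg_trans; apply: near_eq_cvg; near=> n.
congr (_ ^+ _).
have C0 : cos (pi / n%:R) != 0 :> R by near: n.
apply: (mulIf C0); rewrite divfK// mulrBl mul1r divfK//.
have -> : pi / (n - c)%:R = s n + d n by rewrite /s /d; move: (pi / n%:R) (pi / (n - c)%:R) => x y; field.
have -> : pi / n%:R = s n - d n by rewrite /s /d; move: (pi / n%:R) (pi / (n - c)%:R) => x y; field.
by rewrite cosB cosD; ring.
Unshelve. all: by end_near. Qed.

(** The constant [4 / pi] depends neither on [b] nor on [c], so it cancels and only the eigenvalue
    ratio remains. *)
Lemma cvg_survival_ratio (alpha : R) (b c : nat) : 0 < alpha ->
  survival (n - c) (n./2 - b) (time_horizon alpha n) /
  survival n n./2 (time_horizon alpha n) @[n --> \oo]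
    --> expR (- (alpha / 2 * c%:R)).
Proof.
move=> a0.
have p0 : 4 / pi != 0 :> R by rewrite mulf_neq0 ?invr_eq0 ?lt0r_neq0 ?pi_gt0.
have h0 : survival n n./2 (time_horizon alpha n)
    / cos (pi / n%:R : R) ^+ time_horizon alpha n @[n --> \oo] --> 4 / pi.
  by have := cvg_survival alpha 0 0 a0; under eq_cvg do rewrite !subn0.
pose q n := survival (n - c) (n./2 - b) (time_horizon alpha n)
  / cos (pi / (n - c)%:R : R) ^+ time_horizon alpha n.
have : q n / (survival n n./2 (time_horizon alpha n) / cos (pi / n%:R) ^+ time_horizon alpha n)
    * (cos (pi / (n - c)%:R) / cos (pi / n%:R)) ^+ time_horizon alpha n @[n --> \oo]
    --> 4 / pi / (4 / pi) * expR (- (alpha / 2 * c%:R)).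
  apply: cvgM; last exact: cvg_eigenvalue_ratio.
  by apply: cvgM; [exact: cvg_survival|exact: cvgV].
rewrite divff// mul1r; apply: cvg_trans; apply: near_eq_cvg; near=> n.
have : survival n n./2 (time_horizon alpha n) / cos (pi / n%:R) ^+ time_horizon alpha n != 0 :> R.
  by near: n; exact: (cvgr_neq0 _ h0 p0).
have : cos (pi / (n - c)%:R) ^+ time_horizon alpha n != 0 :> R.
  apply: expf_neq0; near: n.
  exact: (cvgr_neq0 _ (cvg_eigenvalue c) (oner_neq0 R)).
rewrite mulf_eq0 negb_or invr_eq0 /q expr_div_n => + /andP[].
move: (_ ^+ _) (_ ^+ _) (survival _ _ _) (survival _ _ _) => x y u v x0 v0 y0.
by field; rewrite ?x0 ?y0 ?v0.
Unshelve. all: by end_near. Qed.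

End asymptotics.

(** * Confined paths on the ring *)

Section path_sums.
Context {R : realType} {n : nat}.
Implicit Types (K : pred 'I_n) (t : nat) (x y : 'I_n).

Definition path_weight {t} (X : trajectory n t) : R :=
  \prod_(s < t) srw_kernel R (X (widen_ord (leqnSn t) s)) (X (lift ord0 s)).

Definition confined_mass K t x : R :=
  \sum_(X : trajectory n t | (X ord0 == x) && [forall s, K (X s)]) path_weight X.

Definition trajectory_cons {t} x (X : trajectory n t) : trajectory n t.+1 :=
  [ffun i => oapp X x (unlift ord0 i)].

Lemma trajectory_cons0 t x (X : trajectory n t) : trajectory_cons x X ord0 = x.
Proof. by rewrite ffunE unlift_none. Qed.

Lemma trajectory_consS t x (X : trajectory n t) i :
  trajectory_cons x X (lift ord0 i) = X i.
Proof. by rewrite ffunE liftK. Qed.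

Lemma path_weight_cons t x (X : trajectory n t) :
  path_weight (trajectory_cons x X) = srw_kernel R x (X ord0) * path_weight X.
Proof.
rewrite /path_weight big_ord_recl; congr (_ * _).
  by rewrite trajectory_consS (_ : widen_ord _ _ = ord0) ?trajectory_cons0//; exact: val_inj.
apply: eq_bigr => s _; rewrite trajectory_consS.
rewrite (_ : widen_ord _ _ = lift ord0 (widen_ord (leqnSn t) s)) ?trajectory_consS//.
exact: val_inj.
Qed.

Lemma forall_trajectory_cons K t x (X : trajectory n t) :
  [forall s, K (trajectory_cons x X s)] = K x && [forall s, K (X s)].
Proof.
apply/forallP/andP => [h|[Kx /forallP KX] s].
  split; first by have := h ord0; rewrite trajectory_cons0.
  by apply/forallP => s; have := h (lift ord0 s); rewrite trajectory_consS.
by case: (unliftP ord0 s) => [j ->|->]; rewrite ?trajectory_consS ?trajectory_cons0.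
Qed.

Lemma confined_mass_out K t x : ~~ K x -> confined_mass K t x = 0.
Proof.
move=> Kx; rewrite /confined_mass big_pred0// => X; apply/negP => /andP[/eqP Xx].
by move=> /forallP/(_ ord0); rewrite Xx (negbTE Kx).
Qed.

Lemma confined_mass0 K x : K x -> confined_mass K 0 x = 1.
Proof.
move=> Kx; rewrite /confined_mass (big_pred1 [ffun=> x]) => [|X].
  by rewrite /path_weight big_ord0.
apply/andP/eqP => [[/eqP Xx _]|->].
  by apply/ffunP => i; rewrite ffunE ord1.
by split; [rewrite ffunE|apply/forallP => s; rewrite ffunE].
Qed.

(** First-step decomposition: paths from [x] correspond to their tails, which are then grouped by
    their first site [y]. *)
Lemma confined_massS K t x : K x ->
  confined_mass K t.+1 x = \sum_y srw_kernel R x y * confined_mass K t y.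
Proof.
move=> Kx; rewrite /confined_mass.
rewrite (reindex_onto (trajectory_cons x) (fun X => [ffun i => X (lift ord0 i)])) /=; last first.
  move=> X /andP[/eqP Xx _]; apply/ffunP => i.
  by case: (unliftP ord0 i) => [j ->|->]; rewrite ?trajectory_consS ?trajectory_cons0 ?ffunE.
under eq_bigl => X.
  rewrite trajectory_cons0 eqxx forall_trajectory_cons Kx /=.
  rewrite (_ : [ffun _ => _] == X) ?andbT; last first.
    by apply/eqP/ffunP => i; rewrite ffunE trajectory_consS.
  over.
rewrite (partition_big (fun X : trajectory n t => X ord0) predT)//=.
apply: eq_bigr => y _; rewrite mulr_sumr.
apply: eq_big => [X|X /andP[_ /eqP <-]]; first by rewrite andbC.
exact: path_weight_cons.
Qed.

Lemma sum_srw_kernel x (f : 'I_n -> R) : (3 <= n)%N ->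
  \sum_y srw_kernel R x y * f y = (f (ord_pred x) + f (ordS x)) / 2.
Proof.
move=> n3.
(* On a ring with two sites both neighbours would coincide; this is where [3 <= n] is used. *)
have neq : ordS x != ord_pred x.
  apply/eqP => /(congr1 val) /=.
  have [x0|x0] := eqVneq (x : nat) 0%N.
    by rewrite x0 add0n modn_small ?modn_small; lia.
  rewrite (_ : (x + n).-1 = x.-1 + n)%N; last by lia.
  rewrite modnDr (@modn_small x.-1); last by have := ltn_ord x; lia.
  have [xn|xn] := eqVneq x.+1 n; first by rewrite xn modnn; lia.
  by rewrite modn_small; have := ltn_ord x; lia.
rewrite (bigD1 (ordS x))// (bigD1 (ord_pred x)) /=; last by rewrite eq_sym.
rewrite big1 => [|y /andP[yS yp]].
  rewrite /srw_kernel /ring_edge ord_predK !eqxx orbT /= addr0.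
  by rewrite addrC -mulrDr mulrC.
rewrite /srw_kernel /ring_edge (negbTE yS) /=.
case: eqP => [xE|]; last by rewrite mul0r.
by move: yp; rewrite xE ordSK eqxx.
Qed.

(** Both sides obey the same recursion in [t] with the same initial and boundary values. [K] matters
    only at the barriers and between them, since nearest-neighbour steps cannot cross a barrier.
    Reading [e] modulo [n] lets [e = n] stand for the origin. *)
Lemma confined_mass_survival K (b e t : nat) x : (3 <= n)%N -> (b < e <= n)%N ->
  (forall y : 'I_n, (b < y < e)%N -> K y) ->
  (forall y : 'I_n, (y == b :> nat) || (y == e %% n :> nat)%N -> ~~ K y) ->
  (b <= x <= e)%N -> confined_mass K t x = survival (e - b) (x - b) t.
Proof.
move=> n3 /andP[be en] Kin Kout.
elim: t x => [|t IHt] x /andP[bx xe].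
all: have [xb|xb] := eqVneq (x : nat) b;
  first by rewrite xb subnn survival_left confined_mass_out// Kout// xb eqxx.
all: have [xE|xE] := eqVneq (x : nat) e;
  first by rewrite xE survival_right confined_mass_out// Kout// -xE modn_small ?eqxx ?orbT.
all: have Kx : K x by apply: Kin; lia.
  by rewrite confined_mass0// survival_start//; lia.
have xn := ltn_ord x.
rewrite confined_massS// sum_srw_kernel//.
have -> : (x - b = (x - b).-1.+1)%N by lia.
rewrite survival_step; congr ((_ + _) / _).
  have pE : ord_pred x = x.-1 :> nat.
    by rewrite /= (_ : (x + n).-1 = x.-1 + n)%N ?modnDr ?modn_small; lia.
  by rewrite IHt pE; [congr survival|]; lia.
(* Here [e = n] and the successor wraps around to the origin, which is excluded by [K]. *)
have [Sn|Sn] := eqVneq x.+1 n.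
  rewrite confined_mass_out; last first.
    by apply: Kout; rewrite (_ : e = n) /= ?Sn ?modnn ?orbT; lia.
  by rewrite (_ : _.-1.+2 = e - b)%N ?survival_right//; lia.
have SE : ordS x = x.+1 :> nat by rewrite /= modn_small; lia.
by rewrite IHt SE; [congr survival|]; lia.
Qed.

Lemma srw_prob_confined K t x :
  srw_prob R x [set X : trajectory n t | forall s, K (X s)] = confined_mass K t x.
Proof.
rewrite /srw_prob /confined_mass /srw_mass.
rewrite [LHS](bigID (fun X : trajectory n t => X ord0 == x)) /= addrC big1 ?add0r; last first.
  by move=> X /andP[_ Xx]; rewrite val_eqE (negbTE Xx) mul0r.
apply: eq_big => [X|X /andP[_ /eqP->]]; last by rewrite eqxx mul1r.
rewrite andbC; congr (_ && _).
by apply/idP/forallP => [|h]; rewrite inE.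
Qed.

End path_sums.

(** * Convergence of the law on a window *)

Lemma cvg_sum_seq (R : realType) (I : finType) (P : pred I) (p : nat -> I -> R) (q : I -> R) :
  (forall i, P i -> p n i @[n --> \oo] --> q i) ->
  \sum_(i | P i) p n i @[n --> \oo] --> \sum_(i | P i) q i.
Proof. by move=> h; apply: cvg_big => //; exact: add_continuous. Qed.

(* Downward induction on the cardinal of [S]: the mass of [S] is the mass of
   its supersets minus that of its strict supersets. *)
Lemma cvg_superset_sums (R : realType) (I : finType)
    (p : nat -> {set I} -> R) (q : {set I} -> R) :
  (forall A : {set I}, \sum_(S : {set I} | A \subset S) p n S @[n --> \oo]
     --> \sum_(S : {set I} | A \subset S) q S) ->
  forall S, p n S @[n --> \oo] --> q S.
Proof.
move=> h S; have [k] := ubnP (#|I| - #|S|)%N; elim: k S => // k IHk S Sk.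
have splitS (f : {set I} -> R) :
    f S = \sum_(S' : {set I} | S \subset S') f S' - \sum_(S' : {set I} | S \proper S') f S'.
  rewrite (bigD1 S)//=; under [X in _ = _ - X]eq_bigl do rewrite finset.properEneq andbC eq_sym.
  by rewrite addrK.
rewrite (splitS q); under eq_cvg do rewrite splitS.
apply: cvgB; first exact: h.
apply: cvg_sum_seq => S' /proper_card SS'; apply: IHk.
by have := max_card S'; lia.
Qed.

(** Walk-side counterpart of [probability_sum]. The predicate [G] is arbitrary so as to serve both
    the superset events and the final event on the window. *)
Lemma srw_cond_prob_sum (R : realType) (n t x0 : nat) (J : finType)
    (code : trajectory n t -> J) (G : pred J) :
  srw_cond_prob R x0 [set X | G (code X)] =
  \sum_(S | G S) srw_cond_prob R x0 [set X | code X = S].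
Proof.
rewrite /srw_cond_prob -mulr_suml; congr (_ / _).
rewrite /srw_prob (partition_big code G) => [|X] /=; last first.
  by rewrite in_setI => /andP[]; rewrite inE.
apply: eq_bigr => S GS; apply: eq_bigl => X.
rewrite !in_setI andbAC; congr (_ && _).
apply/andP/idP; rewrite !inE; first by move=> [_ /eqP].
by move=> /= ->; split.
Qed.

Lemma code_preimage_bigcup (T : Type) (J : finType) (code : T -> J) (G : pred J) :
  [set w | G (code w)] = \bigcup_(S in [set` enum G]) [set w | code w = S].
Proof.
apply/seteqP; split => [w Gw|w [S]] /=.
  by exists (code w) => //=; rewrite mem_enum.
by rewrite mem_enum => GS ->.
Qed.

Lemma measurable_code (d : measure_display) (T : measurableType d) (J : finType)
    (code : T -> J) (G : pred J) :
  (forall S, measurable [set w | code w = S]) -> measurable [set w | G (code w)].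
Proof.
move=> mcode; rewrite code_preimage_bigcup.
by apply: fin_bigcup_measurable => //; exact: finite_finset.
Qed.

Lemma probability_sum (R : realType) (d : measure_display) (T : measurableType d)
    (P : probability T R) (J : finType) (code : T -> J) (G : pred J) :
  (forall S, measurable [set w | code w = S]) ->
  fine (P [set w | G (code w)]) = \sum_(S | G S) fine (P [set w | code w = S]).
Proof.
move=> mcode; rewrite code_preimage_bigcup measure_fin_bigcup//.
- rewrite -fsbig_seq ?enum_uniq// big_enum /=.
  by rewrite sum_fine// => S _; exact: fin_num_measure.
- by move=> S S' _ _ [w [/= <- <-]].
Qed.

Lemma Diam_eq (B : {fset int}) (l u : int) : l \in B -> u \in B ->
  (forall z, z \in B -> l <= z <= u) -> Diam B = u - l.
Proof.
move=> lB uB luB.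
(* The initial value of the iterated maximum and minimum belongs to [B], so it does not affect
   either of them. *)
have hB : head 0 B \in B.
  have mem_hd (s : seq int) : l \in s -> head 0 s \in s.
    by case: s => // h s _; exact: mem_head.
  exact: mem_hd lB.
have maxB : \big[Order.max/head 0 B]_(z <- B) z = u.
  apply/eqP; rewrite eq_le; apply/andP; split; last exact: le_bigmax_seq.
  rewrite big_seq; apply: bigmax_le => [|z zB]; first by have /andP[] := luB _ hB.
  by have /andP[] := luB _ zB.
have minB : \big[Order.min/head 0 B]_(z <- B) z = l.
  apply/eqP; rewrite eq_le; apply/andP; split; first exact: ge_bigmin_seq.
  rewrite big_seq; apply: le_bigmin => [|z zB]; first by have /andP[] := luB _ hB.
  by have /andP[] := luB _ zB.
by rewrite /Diam maxB minB.
Qed.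

(** * Finite coding of configurations in the window *)

Section window.
Context (a b : nat).
Local Notation I := 'I_(a + b).+1.

Definition site (i : I) : int := i%:Z - a%:Z.

(** A finite type of traces reduces convergence in law on the window to convergence of finitely many
    masses. *)
Definition window_code (U : set int) : {set I} := [set i | `[< U (site i) >]].

Definition window_decode (S : {set I}) : set int := [set z | exists2 i, i \in S & z = site i].

Lemma window_codeK (U : set int) : window_decode (window_code U) = U `&` window a b.
Proof.
apply/seteqP; split => z /=.
  move=> [i]; rewrite inE => /asboolP Ui ->; split => //.
  by rewrite /window /site /=; have := ltn_ord i; lia.
move=> [Uz]; rewrite /window /= => /andP[az zb].
have iP : (`|(z + a%:Z)%R|%N < (a + b).+1)%N by lia.
have siteE : site (Ordinal iP) = z by rewrite /site /=; lia.
by exists (Ordinal iP); [rewrite inE; apply/asboolP; rewrite siteE|].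
Qed.

Lemma subset_window_code (A : {set I}) (U : set int) :
  A \subset window_code U <-> forall i, i \in A -> U (site i).
Proof.
split => [/fintype.subsetP h i /h|h]; first by rewrite inE => /asboolP.
by apply/fintype.subsetP => i /h Ui; rewrite inE; apply/asboolP.
Qed.

(** Truncated subtraction makes sites right of the origin count as 0, so this is [- min(A U {0})] in
    window coordinates; [right_extent] is the corresponding maximum. *)
Definition left_extent (A : {set I}) : nat := \max_(i in A) (a - i).
Definition right_extent (A : {set I}) : nat := \max_(i in A) (i - a).

Lemma left_extent_le (A : {set I}) : (left_extent A <= a)%N.
Proof. by apply/bigmax_leqP => i _; exact: leq_subr. Qed.

Lemma right_extent_le (A : {set I}) : (right_extent A <= b)%N.
Proof. by apply/bigmax_leqP => i _; have := ltn_ord i; lia. Qed.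

Lemma extent_ge (A : {set I}) i : i \in A ->
  (a - i <= left_extent A)%N /\ (i - a <= right_extent A)%N.
Proof. by move=> iA; split; exact: (leq_bigmax_cond _ iA). Qed.

Lemma left_extentP (A : {set I}) : (0 < left_extent A)%N ->
  exists2 i, i \in A & (a - i = left_extent A)%N.
Proof.
have [->|[i0 i0A]] := finset.set_0Vmem A; first by rewrite /left_extent big_set0.
have A0 : (0 < #|A|)%N by apply/card_gt0P; exists i0.
by have [i iA iE] := eq_bigmax_cond (fun i : I => a - i)%N A0; exists i.
Qed.

Lemma right_extentP (A : {set I}) : (0 < right_extent A)%N ->
  exists2 i, i \in A & (i - a = right_extent A)%N.
Proof.
have [->|[i0 i0A]] := finset.set_0Vmem A; first by rewrite /right_extent big_set0.
have A0 : (0 < #|A|)%N by apply/card_gt0P; exists i0.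
by have [i iA iE] := eq_bigmax_cond (fun i : I => i - a)%N A0; exists i.
Qed.

Lemma Diam_sites (A : {set I}) :
  Diam (0 |` [fset site i | i in A])%fset = (left_extent A + right_extent A)%:Z.
Proof.
rewrite (@Diam_eq _ (- (left_extent A)%:Z) (right_extent A)%:Z).
- by rewrite opprK addrC -PoszD.
- have [->|] := posnP (left_extent A); first by rewrite oppr0 !inE eqxx.
  move=> /left_extentP[i iA <-]; rewrite !inE; have [//|iE] := eqVneq (- (a - i)%:Z)%R 0.
  by apply/imfsetP; exists i => //; rewrite /site; lia.
- have [->|] := posnP (right_extent A); first by rewrite !inE eqxx.
  move=> /right_extentP[i iA <-]; rewrite !inE; have [//|iE] := eqVneq ((i - a)%N : int) 0.
  by apply/imfsetP; exists i => //; rewrite /site; lia.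
- move=> z; rewrite !inE => /predU1P[->|/imfsetP[i /= /extent_ge[il ir] ->]].
    by rewrite oppr_le0.
  by rewrite /site; lia.
Qed.

Lemma superset_law (R : realType) (alpha : R)
    (d : measure_display) (T : measurableType d) (P : probability T R)
    (V : T -> set int) (hV : interlacement_vacant_set alpha P V) (A : {set I}) :
  fine (P [set w | A \subset window_code (V w)]) =
  expR (- (alpha / 2 * (left_extent A + right_extent A)%:R)).
Proof.
have [_ /(_ [fset site i | i in A]%fset)] := hV.
rewrite Diam_sites (_ : [set w | _] = [set w | A \subset window_code (V w)]) => [->//|].
apply/seteqP; split => w /=.
  by move=> h; apply/subset_window_code => i iA; apply: h; apply/imfsetP; exists i.
by move=> /subset_window_code h z /= /imfsetP[i /= /h Ui ->].
Qed.

(** Prescribing the code is a finite intersection of events [z \in V] and their complements. *)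
Lemma measurable_window_code (R : realType) (alpha : R)
    (d : measure_display) (T : measurableType d) (P : probability T R)
    (V : T -> set int) (hV : interlacement_vacant_set alpha P V) (S : {set I}) :
  measurable [set w | window_code (V w) = S].
Proof.
have [mV _] := hV.
rewrite (_ : [set w | _] = \bigcap_(i in [set: I])
    (if i \in S then [set w | V w (site i)] else ~` [set w | V w (site i)])).
  apply: fin_bigcap_measurable; first exact: finite_finset.
  by move=> i _; case: ifP => _; [exact: mV|exact/measurableC/mV].
apply/seteqP; split => w /=.
  move=> <- i _; rewrite inE; case: ifPn => [/asboolP//|/asboolPn//].
move=> h; apply/setP => i; rewrite inE; have := h i Logic.I.
by case: ifPn => [iS /asboolP ->//|iS /= /asboolPn/negbTE ->].
Qed.

(** On the ring, the extreme points of [A] together with the origin become barriers at [r] and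
    [n - l], with the start [n./2] between them. The lower bound on [n] keeps this order. The
    denominator is the case of barriers [0] and [n]. *)
Lemma srw_superset (R : realType) (n t : nat) (A : {set I}) :
  (2 * (a + b) + 3 <= n)%N ->
  srw_cond_prob R n./2
    [set X : trajectory n t | A \subset window_code (ring_lift (vacant_set X))] =
  survival (n - (left_extent A + right_extent A)) (n./2 - right_extent A) t
    / survival n n./2 t.
Proof.
move=> nab.
have la := left_extent_le A; have rb := right_extent_le A.
have hn : (n./2 < n)%N by lia.
pose x := Ordinal hn.
pose avoids (y : 'I_n) := y != 0%N :> nat.
(* Adding [n] first keeps the natural subtraction from truncating. *)
pose site_mod (i : I) := ((n + i - a) %% n)%N.
pose avoidsA (y : 'I_n) := avoids y && [forall i in A, y != site_mod i :> nat].
have site_modE (i : I) : (site i %% n%:Z)%Z = site_mod i.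
  rewrite /site /site_mod -modzDl -modz_nat; congr (_ %% _)%Z; lia.
have den : srw_prob R n./2 (@avoids_origin n t) = survival n n./2 t.
  rewrite -[n./2]/(x : nat) -/avoids (srw_prob_confined avoids).
  rewrite (confined_mass_survival _ 0 n) ?subn0//.
  - by lia.
  - by lia.
  - by move=> y /andP[]; rewrite /avoids lt0n.
  - by move=> y; rewrite modnn orbb /avoids negbK.
  - by rewrite /=; lia.
rewrite /srw_cond_prob den; congr (_ / _).
rewrite [X in srw_prob _ _ X](_ : _ = [set X : trajectory n t | forall s, avoidsA (X s)]); last first.
  apply/seteqP; split => X /=.
    move=> [/subset_window_code h X0] s; apply/andP; split; first exact: X0.
    apply/forallP => i; apply/implyP => iA.
    have [y Xy yE] := h i iA; apply/eqP => XsE.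
    have := Xy s; apply/negP; rewrite negbK -val_eqE /= XsE.
    by move: yE; rewrite site_modE => -[->].
  move=> h; split; last by move=> s; have /andP[] := h s.
  apply/subset_window_code => i iA.
  have sn : (site_mod i < n)%N by rewrite ltn_mod; lia.
  exists (Ordinal sn); last by rewrite site_modE.
  move=> s; have /andP[_ /forallP/(_ i)] := h s.
  by rewrite iA.
rewrite -[n./2]/(x : nat) (srw_prob_confined avoidsA).
rewrite (confined_mass_survival _ (right_extent A) (n - left_extent A)).
- by congr survival; rewrite /=; lia.
- by lia.
- by lia.
- move=> y /andP[y1 y2]; rewrite /avoidsA /avoids; apply/andP; split; first by lia.
  apply/forallP => i; apply/implyP => /extent_ge[il ir]; rewrite /site_mod.
  have [ia|ia] := leqP a i.
    rewrite (_ : n + i - a = i - a + n)%N ?modnDr ?modn_small; have := ltn_ord i; lia.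
  by rewrite modn_small; lia.
(* Each barrier is the origin when its extent is 0, and otherwise a site of [A] attaining the
   extent. *)
- move=> y /orP[/eqP yE|/eqP yE]; rewrite /avoidsA /avoids negb_and negbK.
    have [r0|r0] := posnP (right_extent A); first by rewrite yE r0.
    have [i iA iE] := right_extentP _ r0.
    apply/orP; right; apply/forallPn; exists i; rewrite iA negbK /site_mod.
    rewrite (_ : n + i - a = i - a + n)%N ?modnDr ?modn_small; have := ltn_ord i; lia.
  have [r0|r0] := posnP (left_extent A); first by rewrite yE r0 subn0 modnn.
  have [i iA iE] := left_extentP _ r0.
  apply/orP; right; apply/forallPn; exists i; rewrite iA negbK /site_mod.
  by rewrite yE -iE; apply/eqP; congr (_ %% _)%N; lia.
- by rewrite /=; lia.
Qed.

End window.

Theorem theorem1p1 (R : realType) (alpha : R) (halpha : 0 < alpha)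
    (d : measure_display) (T : measurableType d) (P : probability T R)
    (V : T -> set int) (hV : interlacement_vacant_set alpha P V)
    (a b : nat) (ha : (0 < a)%N) (hb : (0 < b)%N)
    (F : set (set int)) :
  (srw_cond_prob R n./2
     [set X : trajectory n (time_horizon alpha n) |
        F (ring_lift (vacant_set X) `&` window a b)])%:E
    @[n --> \oo] --> P [set w | F (V w `&` window a b)].
Proof.
(* [F] is transported to codes, so that the event depends on a finite-valued variable only. *)
pose G (S : {set 'I_(a + b).+1}) := `[< F (window_decode a b S) >].
have FG (U : set int) : F (U `&` window a b) = G (window_code a b U).
  by rewrite -window_codeK /G asboolE.
have mcode := measurable_window_code a b _ _ _ _ _ _ hV.
pose p n (S : {set 'I_(a + b).+1}) : R := srw_cond_prob R n./2
  [set X : trajectory n (time_horizon alpha n) |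
     window_code a b (ring_lift (vacant_set X)) = S].
pose q (S : {set 'I_(a + b).+1}) : R := fine (P [set w | window_code a b (V w) = S]).
have pq : forall S, p n S @[n --> \oo] --> q S.
  (* It suffices to treat the events that [A] is vacant, whose probabilities are explicit on both
     sides. *)
  apply: cvg_superset_sums => A.
  rewrite -(probability_sum _ _ _ P _ _ (fun S : {set _} => A \subset S) mcode).
  rewrite (superset_law a b _ _ _ _ _ _ hV).
  apply: cvg_trans (cvg_survival_ratio alpha (right_extent a b A)
    (left_extent a b A + right_extent a b A) halpha).
  apply: near_eq_cvg; near=> n.
  rewrite -(srw_cond_prob_sum _ _ _ _ _ _ (fun S : {set _} => A \subset S)).
  rewrite srw_superset//; near: n; exact: nbhs_infty_ge.
have -> : [set w | F (V w `&` window a b)] = [set w | G (window_code a b (V w))].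
  by apply/seteqP; split => w /=; rewrite FG.
rewrite -[P _]fineK; last first.
  exact/fin_num_measure/measurable_code.
apply: cvg_EFin; first exact: nearW.
rewrite (probability_sum _ _ _ P _ _ G mcode).
(* Both probabilities are the finite sum of the masses of the codes in [G]. *)
apply: cvg_trans (cvg_sum_seq _ _ _ _ _ (fun S _ => pq S)).
apply: near_eq_cvg; near=> n => /=.
rewrite -srw_cond_prob_sum; congr (srw_cond_prob _ _ _).
by apply/seteqP; split => X /=; rewrite FG.
Unshelve. all: by end_near. Qed.
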